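(* For any $n$ red points and $n$ blue points in $\mathbb{R}^d$, there exists a red-blue Tverberg matching; that is, there exists a perfect matching $\mathcal{M}$ of the $2n$ points, each edge of which joins a red point to a blue point, such that $$\bigcap_{rb\in \mathcal{M}} B(rb)\neq\emptyset .$$
   Context: For two points $x,y\in\mathbb{R}^d$, $B(xy)$ denotes the closed Euclidean ball for which the segment $xy$ is a diameter, i.e. the closed ball with center $\frac{x+y}{2}$ and radius $\frac{\|x-y\|}{2}$. A graph $G$ whose vertices are finitely many points in $\mathbb{R}^d$ is called a Tverberg graph if $\bigcap_{xy\in E(G)}B(xy)\neq\emptyset$; a perfect matching that is a Tverberg graph is called a Tverberg matching. A perfect matching is red-blue if every edge connects points of different colors (equivalently, it is given by a bijection from the red points to the blue points). *)

(* Defs.v *)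
From HB Require Import structures.
From mathcomp Require Import all_boot all_order all_algebra.
From mathcomp Require Import all_classical all_reals.

Set Implicit Arguments.
Unset Strict Implicit.
Unset Printing Implicit Defensive.

Import Order.TTheory GRing.Theory Num.Theory.

Local Open Scope classical_set_scope.
Local Open Scope ring_scope.

(* The norm that MathComp-Analysis puts on 'rV[R]_d is the sup norm, hence
   the explicit Euclidean norm. *)
Definition enorm (R : realType) (d : nat) (x : 'rV[R]_d) : R :=
  Num.sqrt (\sum_(k < d) x ord0 k ^+ 2).

Definition eball (R : realType) (d : nat) (c : 'rV[R]_d) (rho : R) :
  set 'rV[R]_d := [set p | enorm (p - c) <= rho].

Definition diam_ball (R : realType) (d : nat) (x y : 'rV[R]_d) :
  set 'rV[R]_d := eball (2^-1 *: (x + y)) (enorm (x - y) / 2).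

Definition simple_graph (V : finType) (E : rel V) : Prop :=
  symmetric E /\ irreflexive E.

Definition perfect_matching (V : finType) (E : rel V) : Prop :=
  simple_graph E /\ forall v : V, #|[set w | E v w]%SET| = 1%N.

Definition bichromatic (V : finType) (is_red : pred V) (E : rel V) : Prop :=
  forall v w : V, E v w -> is_red v != is_red w.

(* The vertices are labels, and the point of a vertex is given by pt, so that
   points may coincide.  With no edge the intersection is the whole space. *)
Definition tverberg_graph (R : realType) (d : nat) (V : finType)
    (pt : V -> 'rV[R]_d) (E : rel V) : Prop :=
  \bigcap_(e in [set e : V * V | E e.1 e.2])
    diam_ball (pt e.1) (pt e.2) !=set0.

Definition red_blue_points (R : realType) (d n : nat)
    (r b : 'I_n -> 'rV[R]_d) (v : 'I_n + 'I_n) : 'rV[R]_d :=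
  match v with inl i => r i | inr j => b j end.

Definition is_red (n : nat) (v : 'I_n + 'I_n) : bool :=
  match v with inl _ => true | inr _ => false end.

(* Main.v *)
Require Import Defs.
From mathcomp Require Import all_boot all_order all_algebra all_fingroup.
From mathcomp Require Import all_classical all_reals.
From mathcomp Require Import topology normedtype derive.
From mathcomp Require Import ring lra.

(** A point [p] lies in the ball with diameter [xy] iff the angle [xpy] is not
    acute, i.e. iff [dot (x - p) (y - p) <= 0] ([diam_ballP]). The matching to
    take is one of maximal sum of squared edge lengths, that is, a bijection
    minimizing the sum of the [dot (r i) (b (s i))]. Exchanging the partners of
    two red points cannot decrease this sum, which says that the matching is
    antimonotone: [dot (r i - r j) (b (s i) - b (s j)) <= 0] for all [i], [j]
    ([ex_antimonotone_matching]).

    Put [q i = b (s i)], [m i = (r i + q i) / 2] and [c i = dot (r i) (q i)].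
    A common point is a point [p] at which the quadratic functions
    [dot (r i - p) (q i - p) = |p|^2 - 2 dot p (m i) + c i] are all
    nonpositive. They share the leading term [|p|^2], so for weights [w] in the
    simplex their weighted mean is least at the barycenter of the [m i], where
    it equals [sum_i w i * c i - |sum_i w i * m i|^2]. Maximizing this concave
    function of [w] over the simplex solves the dual of the problem of
    minimizing the largest of these functions; the first-order conditions at a
    maximizer [w] say that the barycenter [p] for [w] makes every one of them at
    most the dual value ([quadratic_minimax]).

    It remains to see that the dual function is nowhere positive. Let [x] and
    [y] be the barycenters of the [r i] and the [q i]. The product weights
    [w i * w j] being symmetric in [i] and [j], averaging the antimonotonicity
    inequalities against them gives [sum_i w i * c i <= dot x y]
    ([antimonotone_barycenter]), and [dot x y <= |(x + y) / 2|^2]. *)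

Set Implicit Arguments.
Unset Strict Implicit.
Unset Printing Implicit Defensive.

Import Order.TTheory GRing.Theory Num.Theory.
Import numFieldNormedType.Exports.

Local Open Scope classical_set_scope.
Local Open Scope ring_scope.

(** * The Euclidean inner product *)

Definition dot (R : realType) (d : nat) (x y : 'rV[R]_d) : R :=
  \sum_(k < d) x ord0 k * y ord0 k.

Section Dot.
Context {R : realType} {d : nat}.
Implicit Types x y z : 'rV[R]_d.

Lemma dotC x y : dot x y = dot y x.
Proof. by apply: eq_bigr => k _; rewrite mulrC. Qed.

Lemma dotDl x y z : dot (x + y) z = dot x z + dot y z.
Proof.
by rewrite /dot -big_split; apply: eq_bigr => k _; rewrite mxE mulrDl.
Qed.

Lemma dotZl a x y : dot (a *: x) y = a * dot x y.
Proof.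
by rewrite /dot mulr_sumr; apply: eq_bigr => k _; rewrite mxE mulrA.
Qed.

Lemma dotNl x y : dot (- x) y = - dot x y.
Proof. by rewrite -scaleN1r dotZl mulN1r. Qed.

Lemma dotDr x y z : dot z (x + y) = dot z x + dot z y.
Proof. by rewrite !(dotC z) dotDl. Qed.

Lemma dotZr a x y : dot y (a *: x) = a * dot y x.
Proof. by rewrite !(dotC y) dotZl. Qed.

Lemma dotNr x y : dot y (- x) = - dot y x.
Proof. by rewrite !(dotC y) dotNl. Qed.

Definition dotE := (dotDl, dotDr, dotNl, dotNr, dotZl, dotZr).

Lemma dot_suml (I : finType) (x : I -> 'rV[R]_d) y :
  dot (\sum_i x i) y = \sum_i dot (x i) y.
Proof.
rewrite /dot exchange_big; apply: eq_bigr => k _.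
by rewrite summxE mulr_suml.
Qed.

Lemma dot_ge0 x : 0 <= dot x x.
Proof. by apply: sumr_ge0 => k _; rewrite -expr2 sqr_ge0. Qed.

Lemma enormE x : enorm x = Num.sqrt (dot x x).
Proof. by congr Num.sqrt; apply: eq_bigr => k _; rewrite expr2. Qed.

(** Thales: [dot (x - p) (y - p)] is the power of [p] with respect to the
    sphere with diameter [xy]. *)
Lemma diam_ballP x y p : diam_ball x y p <-> dot (x - p) (y - p) <= 0.
Proof.
have h : enorm (x - y) / 2 = Num.sqrt (dot (x - y) (x - y) / 4).
  rewrite enormE sqrtrM ?dot_ge0//; congr (_ * _).
  have -> : (4 : R)^-1 = 2^-1 ^+ 2 by field.
  by rewrite sqrtr_sqr ger0_norm ?invr_ge0 ?ler0n.
have h4 : 0 <= dot (x - y) (x - y) / 4 by rewrite divr_ge0 ?dot_ge0.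
rewrite /diam_ball /eball /= h enormE ler_sqrt // -subr_le0.
suff -> : dot (p - 2^-1 *: (x + y)) (p - 2^-1 *: (x + y))
    - dot (x - y) (x - y) / 4 = dot (x - p) (y - p) by split.
by rewrite !dotE !(dotC p) (dotC y x); field.
Qed.

End Dot.

(** * Weights and barycenters *)

Definition simplex (R : realType) (n : nat) : set 'rV[R]_n :=
  [set w | (forall i, 0 <= w ord0 i) /\ \sum_i w ord0 i = 1].

Definition barycenter (R : realType) (d n : nat) (w : 'rV[R]_n)
    (x : 'I_n -> 'rV[R]_d) : 'rV[R]_d :=
  \sum_i w ord0 i *: x i.

Section Simplex.
Context {R : realType}.

Lemma continuous_sum n (T : topologicalType) (F : 'I_n -> T -> R) :
  (forall i, continuous (F i)) -> continuous (fun x => \sum_i F i x).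
Proof.
by move=> Fc; apply: continuous_big => //; exact: add_continuous.
Qed.

Lemma continuous_weighted_sum n (a : 'I_n -> R) :
  continuous (fun w : 'rV[R]_n => \sum_i w ord0 i * a i).
Proof.
apply: continuous_sum => i w.
apply: (@continuousM _ _ (fun v : 'rV[R]_n => v ord0 i) (fun=> a i)).
  exact: coord_continuous.
exact: cst_continuous.
Qed.

Lemma simplex_compact n : compact (@simplex R n).
Proof.
pose cube := [set w : 'rV[R]_n | forall i, `[0, 1]%classic (w ord0 i)].
apply: (@subclosed_compact _ _ cube).
- have -> : @simplex R n =
      (\bigcap_i (fun w : 'rV[R]_n => w ord0 i) @^-1` [set t | 0 <= t])
      `&` (fun w : 'rV[R]_n => \sum_i w ord0 i * 1) @^-1` [set t | t = 1].
    apply/seteqP; split=> w /=.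
      move=> [w0 w1]; split=> [i _|]; first exact: w0.
      by rewrite -[RHS]w1; apply: eq_bigr => i _; rewrite mulr1.
    move=> [w0 w1]; split=> [i|]; first exact: w0.
    by rewrite -[RHS]w1; apply: eq_bigr => i _; rewrite mulr1.
  apply: closedI.
    apply: closed_bigI => i _; apply: preimage_closed; last exact: closed_ge.
    by move=> w _; exact: coord_continuous.
  apply: preimage_closed; last exact: closed_eq.
  by move=> w _; exact: continuous_weighted_sum.
- by apply: (@rV_compact R n (fun=> `[0, 1]%classic)) => i;
    exact: segment_compact.
- move=> w [w0 w1] i /=; rewrite in_itv /= w0 /= -w1 (bigD1 i) //= lerDl.
  by apply: sumr_ge0.
Qed.

Lemma simplex_delta n (j : 'I_n) : simplex (delta_mx ord0 j : 'rV[R]_n).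
Proof.
split=> [i|]; first by rewrite mxE ler0n.
rewrite (bigD1 j) //= mxE !eqxx big1 ?addr0// => i /negPf ij.
by rewrite mxE ij andbF.
Qed.

Lemma simplex_convex n (w v : 'rV[R]_n) t : 0 <= t <= 1 ->
  simplex w -> simplex v -> simplex ((1 - t) *: w + t *: v).
Proof.
move=> /andP[t0 t1] [w0 w1] [v0 v1]; split=> [i|].
  by rewrite !mxE addr_ge0 ?mulr_ge0 ?subr_ge0.
under eq_bigr do rewrite !mxE.
by rewrite big_split /= -!mulr_sumr w1 v1; ring.
Qed.

Context {d n : nat}.
Implicit Types x y : 'I_n -> 'rV[R]_d.

Lemma barycenter_segment x (w v : 'rV[R]_n) t :
  barycenter ((1 - t) *: w + t *: v) x =
  (1 - t) *: barycenter w x + t *: barycenter v x.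
Proof.
rewrite /barycenter !scaler_sumr -big_split; apply: eq_bigr => i _.
by rewrite /= !scalerA -scalerDl !mxE.
Qed.

Lemma barycenter_delta x j : barycenter (delta_mx ord0 j) x = x j.
Proof.
rewrite /barycenter (bigD1 j) //= mxE !eqxx scale1r big1 ?addr0// => i /negPf ij.
by rewrite mxE ij andbF scale0r.
Qed.

Lemma weighted_sum_segment (c : 'I_n -> R) (w : 'rV[R]_n) j t :
  \sum_i ((1 - t) *: w + t *: delta_mx ord0 j) ord0 i * c i =
  (1 - t) * (\sum_i w ord0 i * c i) + t * c j.
Proof.
have -> : c j = \sum_i (delta_mx ord0 j : 'rV[R]_n) ord0 i * c i.
  rewrite (bigD1 j) //= mxE !eqxx mul1r big1 ?addr0// => i /negPf ij.
  by rewrite mxE ij andbF mul0r.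
rewrite !mulr_sumr -big_split; apply: eq_bigr => i _.
by rewrite /= !mxE mulrDl !mulrA.
Qed.

Lemma barycenter_midpoint x y w :
  barycenter w (fun i => 2^-1 *: (x i + y i)) =
  2^-1 *: (barycenter w x + barycenter w y).
Proof.
rewrite /barycenter -big_split scaler_sumr; apply: eq_bigr => i _ /=.
by rewrite -scalerDr !scalerA mulrC.
Qed.

Lemma dot_barycenter x y w :
  dot (barycenter w x) (barycenter w y) =
  \sum_i \sum_j w ord0 i * w ord0 j * dot (x i) (y j).
Proof.
rewrite dot_suml; apply: eq_bigr => i _.
rewrite dotC dot_suml; apply: eq_bigr => j _.
by rewrite dotZl dotZr dotC; ring.
Qed.

(** Only exchanges of two indices enter: the product weights are symmetric, so
    they pair the term [(i, j)] with the term [(j, i)]. *)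
Lemma antimonotone_barycenter x y w : simplex w ->
  (forall i j, dot (x i - x j) (y i - y j) <= 0) ->
  \sum_i w ord0 i * dot (x i) (y i) <=
  dot (barycenter w x) (barycenter w y).
Proof.
move=> [w0 w1] xy; rewrite dot_barycenter.
set a := fun i j => w ord0 i * w ord0 j.
have diagE : \sum_i w ord0 i * dot (x i) (y i) =
    \sum_i \sum_j a i j * dot (x i) (y i).
  apply: eq_bigr => i _.
  by rewrite -mulr_suml /a -mulr_sumr w1 mulr1.
have diagE' : \sum_i w ord0 i * dot (x i) (y i) =
    \sum_i \sum_j a i j * dot (x j) (y j).
  rewrite diagE exchange_big; apply: eq_bigr => i _; apply: eq_bigr => j _.
  by rewrite /a (mulrC (w _ _)).
have symE : \sum_i \sum_j a i j * dot (x i) (y j) =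
    \sum_i \sum_j a i j * dot (x j) (y i).
  rewrite exchange_big; apply: eq_bigr => i _; apply: eq_bigr => j _.
  by rewrite /a (mulrC (w _ _)).
have : \sum_i \sum_j a i j * dot (x i - x j) (y i - y j) <= 0.
  apply: sumr_le0 => i _; apply: sumr_le0 => j _.
  by rewrite mulr_ge0_le0 ?mulr_ge0.
have -> : \sum_i \sum_j a i j * dot (x i - x j) (y i - y j) =
    \sum_i \sum_j a i j * dot (x i) (y i)
    + \sum_i \sum_j a i j * dot (x j) (y j)
    - (\sum_i \sum_j a i j * dot (x i) (y j)
       + \sum_i \sum_j a i j * dot (x j) (y i)).
  rewrite -!big_split -sumrB; apply: eq_bigr => i _ /=.
  rewrite -!big_split -sumrB; apply: eq_bigr => j _ /=.
  by rewrite !dotE; ring.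
by rewrite -symE -diagE -diagE'; lra.
Qed.

End Simplex.

(** * A minimax theorem for quadratic functions with a common leading term *)

Section Minimax.
Context {R : realType} {d : nat}.

Definition dual_value n (m : 'I_n -> 'rV[R]_d) (c : 'I_n -> R)
    (w : 'rV[R]_n) : R :=
  \sum_i w ord0 i * c i - dot (barycenter w m) (barycenter w m).

Lemma dual_value_continuous n (m : 'I_n -> 'rV[R]_d) (c : 'I_n -> R) :
  continuous (dual_value m c).
Proof.
have coordE (k : 'I_d) : (fun v : 'rV[R]_n => barycenter v m ord0 k) =
    (fun v : 'rV[R]_n => \sum_i v ord0 i * m i ord0 k).
  by apply/funext => v; rewrite summxE; apply: eq_bigr => i _; rewrite mxE.
have coord_cont k : continuous (fun v : 'rV[R]_n => barycenter v m ord0 k).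
  by rewrite coordE; exact: continuous_weighted_sum.
have dot_cont : continuous (fun v : 'rV[R]_n =>
    dot (barycenter v m) (barycenter v m)).
  apply: continuous_sum => k v.
  exact: (continuousM (coord_cont k v) (coord_cont k v)).
move=> w; exact: (continuousB (@continuous_weighted_sum _ _ c w) (dot_cont w)).
Qed.

(** The first-order optimality condition at the end [t = 0] of a segment, in
    the quadratic case where no derivative is called for. *)
Lemma slope_le0 (D Q : R) : 0 <= Q ->
  (forall t, 0 <= t <= 1 -> t * D - t ^+ 2 * Q <= 0) -> D <= 0.
Proof.
move=> Q0 DQ; rewrite leNgt; apply/negP => D0.
have s0 : 0 < D + Q by rewrite ltr_wpDr.
(* this t satisfies both t * Q < D and t <= 1, whatever Q is *)
have := DQ (D / (D + Q)).
rewrite divr_ge0 ?(ltW D0) ?(ltW s0)// ler_pdivrMr// mul1r lerDl Q0 => /(_ isT).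
have -> : D / (D + Q) * D - (D / (D + Q)) ^+ 2 * Q =
    D ^+ 3 / (D + Q) ^+ 2 by field; rewrite gt_eqF.
by rewrite leNgt divr_gt0 ?exprn_gt0.
Qed.

(** At a maximizer [w] of the dual function over the simplex, its derivative
    towards the vertex [j] is the excess over the dual value of the [j]-th
    quadratic function at the barycenter; hence that excess is nonpositive. *)
Lemma quadratic_minimax n (m : 'I_n.+1 -> 'rV[R]_d) (c : 'I_n.+1 -> R) :
  exists2 w : 'rV[R]_n.+1, simplex w &
    let p := barycenter w m in
    forall j, dot p p - 2 * dot p (m j) + c j <= dual_value m c w.
Proof.
have [||| w] := @EVT_max_rV R n.+1 (dual_value m c) (@simplex R n.+1).
- by exists (delta_mx ord0 ord0); exact: simplex_delta.
- exact: simplex_compact.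
- exact/continuous_subspaceT/dual_value_continuous.
rewrite inE => ws wmax; exists w => // p j.
rewrite -subr_le0; apply: (@slope_le0 _ (dot (m j - p) (m j - p))).
  exact: dot_ge0.
move=> t t01.
have /wmax : (1 - t) *: w + t *: delta_mx ord0 j \in @simplex R n.+1.
  by rewrite inE; apply: simplex_convex => //; exact: simplex_delta.
rewrite /dual_value weighted_sum_segment barycenter_segment barycenter_delta.
rewrite -/p -subr_le0 !dotE (dotC (m j) p).
set S := \sum_i _.
by apply: le_trans; rewrite le_eqVlt; apply/orP; left; apply/eqP; ring.
Qed.

End Minimax.

(** * Matchings *)

(** The bijection minimizes [sum_k dot (r k) (b (s k))]; the inequality is the
    comparison with the bijection in which [i] and [j] exchange partners. *)
Lemma ex_antimonotone_matching (R : realType) (d n : nat)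
    (r b : 'I_n -> 'rV[R]_d) :
  exists s : 'S_n, forall i j, dot (r i - r j) (b (s i) - b (s j)) <= 0.
Proof.
pose cost (s : 'S_n) := \sum_k dot (r k) (b (s k)).
have [s _ smin] : extremum_spec <=%R xpredT cost [arg min_(s < 1%g) cost s]%O.
  by apply: Order.TotalTheory.arg_minP.
exists s => i j; have [->|ij] := eqVneq i j.
  by rewrite !subrr -(scale0r 0) dotZl mul0r.
have := smin (tperm i j * s)%g isT.
rewrite /cost (bigD1 i) // (bigD1 j) 1?eq_sym //=.
rewrite [leRHS](bigD1 i) // [in leRHS](bigD1 j) 1?eq_sym //=.
rewrite !permM tpermL tpermR !addrA.
under [X in _ <= _ + X]eq_bigr => k /andP[ki kj].
  rewrite permM tpermD 1?eq_sym //; over.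
by rewrite lerD2r !dotE; lra.
Qed.

Section MatchingGraph.
Context {n : nat}.

Definition matching_graph (s : 'S_n) : rel ('I_n + 'I_n)%type := fun u v =>
  match u, v with
  | inl i, inr j | inr j, inl i => j == s i
  | _, _ => false
  end.

Lemma matching_graph_perfect s : perfect_matching (matching_graph s).
Proof.
split; first by split=> [[i|i] [j|j]|[i|i]].
case=> i.
  rewrite (_ : finset _ = [set inr (s i)])%SET ?cards1 //.
  by apply/setP => -[j|j]; rewrite !inE.
rewrite (_ : finset _ = [set inl ((s^-1)%g i)])%SET ?cards1 //.
apply/setP => -[j|j]; rewrite !inE //=.
rewrite -[RHS]/(j == (s^-1)%g i).
by rewrite -(inj_eq (@perm_inj _ s) j) permKV eq_sym.
Qed.

Lemma matching_graph_bichromatic s :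
  bichromatic (@is_red n) (matching_graph s).
Proof. by case=> [i|i] [j|j]. Qed.

End MatchingGraph.

Theorem theorem4 (R : realType) (d n : nat) (r b : 'I_n -> 'rV[R]_d) :
  exists M : rel ('I_n + 'I_n)%type,
    [/\ perfect_matching M,
        bichromatic (@is_red n) M
      & tverberg_graph (red_blue_points r b) M].
Proof.
have [s anti] := ex_antimonotone_matching r b.
exists (matching_graph s); split.
- exact: matching_graph_perfect.
- exact: matching_graph_bichromatic.
suff [p pP] : exists p, forall i, dot (r i - p) (b (s i) - p) <= 0.
  exists p => -[[i|i] [j|j]] //= /eqP ->; apply/diam_ballP => //=.
  by rewrite dotC.
case: n => [|n] in r b s anti *; first by exists 0; case.
pose q i := b (s i).
have [w ws] := quadratic_minimax (fun i => 2^-1 *: (r i + q i))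
  (fun i => dot (r i) (q i)).
rewrite /dual_value barycenter_midpoint.
have := antimonotone_barycenter (y := q) ws anti.
set S := \sum_i _; set x := barycenter w r; set y := barycenter w q.
set p := 2^-1 *: _ => Sxy pP; exists p => i.
have gap : 0 <= dot p p - dot x y.
  suff -> : dot p p - dot x y = dot (x - y) (x - y) / 4.
    by rewrite divr_ge0 ?dot_ge0.
  by rewrite /p !dotE (dotC y x); field.
move: (pP i) gap; rewrite -/(q i) /=; move: p {pP} => p.
by rewrite !dotE (dotC (r i) p); lra.
Qed.
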